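(* Let $(H,R)$ be a semisimple quasi-triangular Hopf algebra over a field $k$ of characteristic zero, and let $D$ be an $H$-module subcoalgebra of $H_R$. Then the $R$-adjoint-stable algebra $N_D$ of $D$ is isomorphic (as an algebra) to the smash product $D^*\#H^{op}$.
   Context: $S$ is the antipode of $H$; Sweedler notation is used. A quasi-triangular Hopf algebra is a pair $(H,R)$, $R=R^1\otimes R^2\in H\otimes H$ invertible, with $R^1h_{(1)}\otimes R^2h_{(2)}=h_{(2)}R^1\otimes h_{(1)}R^2$, $(\Delta\otimes id)(R)=R^{13}R^{23}$, $(id\otimes\Delta)(R)=R^{13}R^{12}$. $H_R$ is the transmuted braided group: the algebra $H$ with left adjoint action $h\cdot_{ad}h'=h_{(1)}h'S(h_{(2)})$, coproduct $\Delta_R(h)=h_{(1)}S(R^2)\otimes R^1\cdot_{ad}h_{(2)}$, written $\Delta_R(h)=h^{(1)}\otimes h^{(2)}$, and counit $\varepsilon$. An $H$-module subcoalgebra of $H_R$ is a subcoalgebra of $(H,\Delta_R,\varepsilon)$ stable under $\cdot_{ad}$. $N_D=D^*\square_{H_R}(H\otimes D)$ (cotensor product), where $H\otimes D$ has left $H_R$-coaction $h\otimes d\mapsto h_{(1)}\cdot_{ad}d^{(1)}\otimes h_{(2)}\otimes d^{(2)}$ and $D^*$ is the right $H_R$-comodule dual to the left comodule $(D,\Delta_R)$. Its product is $x\circ y=\sum_{l,j}v_l^*\otimes g_lh_j\otimes\langle w_j^*,v_l\rangle w_j$ for $x=\sum_jw_j^*\otimes h_j\otimes w_j$, $y=\sum_lv_l^*\otimes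 g_l\otimes v_l$ in $N_D$. $D^*$ is the convolution algebra of the coalgebra $(D,\Delta_R)$: $\langle f*_Rf',d\rangle=\langle f,d^{(1)}\rangle\langle f',d^{(2)}\rangle$. It is a right $H$-module algebra, equivalently a left $H^{op}$-module algebra, via $\langle f\triangleleft h,d\rangle=\langle f,h\cdot_{ad}d\rangle$. $D^*\#H^{op}$ has product $(f\#h)(f'\#h')=f*_R(f'\triangleleft h_{(1)})\#h'h_{(2)}$. *)

(* Defs.v *)
From HB Require Import structures.
From mathcomp Require Import all_boot all_order all_algebra all_field.

Set Implicit Arguments.
Unset Strict Implicit.
Unset Printing Implicit Defensive.

Import GRing.Theory.
Local Open Scope ring_scope.

Reserved Notation "\sw_ ( a , b <- t ) E"
  (at level 41, a name, b name, t at level 50, E at level 41,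
   format "'[' \sw_ ( a ,  b  <-  t ) '/  '  E ']'").
Reserved Notation "u ⊗ v" (at level 40, left associativity).

(* Tensor products of finite-dimensional vector spaces: an element of          *)
(* tensor V W is its matrix of coordinates in the bases (e_i ⊗ e_j), where     *)
(* (e_i) is the library's basis vbasis fullv of V, resp. of W.                 *)
(* tens_bilinear, tliftE and tens_span give the universal property.            *)
Definition tensor (k : fieldType) (V W : vectType k) : Type :=
  'M[k]_(\dim {: V}, \dim {: W}).

HB.instance Definition _ (k : fieldType) (V W : vectType k) :=
  Vector.copy (tensor V W) 'M[k]_(\dim {: V}, \dim {: W}).

Section Tensor.
Variables (k : fieldType) (V W U : vectType k).

Definition tens (v : V) (w : W) : tensor V W :=
  \matrix_(i, j) (coord (vbasis {: V}) i v * coord (vbasis {: W}) j w).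

(* The linear map out of V ⊗ W induced by a bilinear map f. *)
Definition tlift (f : V -> W -> U) (t : tensor V W) : U :=
  \sum_i \sum_j t i j *: f (vbasis {: V})`_i (vbasis {: W})`_j.

Lemma tlift_is_linear f : linear (tlift f).
Proof.
move=> a s t; rewrite /tlift scaler_sumr -big_split; apply: eq_bigr => i _.
rewrite scaler_sumr -big_split; apply: eq_bigr => j _ /=.
by rewrite !mxE scalerDl scalerA.
Qed.

HB.instance Definition _ f :=
  GRing.isSemilinear.Build k (tensor V W) U _ (tlift f)
    (GRing.semilinear_linear (tlift_is_linear f)).

End Tensor.

Notation "u ⊗ v" := (tens u v) : ring_scope.

(* Sweedler notation: if t is the sum of the tensors a_i ⊗ b_i, and E is        *)
(* bilinear in (a, b), then \sw_(a, b <- t) E is the sum of the E(a_i, b_i).   *)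
Notation "\sw_ ( a , b <- t ) E" := (tlift (fun a b => E) t) : ring_scope.

Section TensorTheory.
Variables (k : fieldType) (V W U : vectType k).

Lemma tens_bilinear :
  (forall w : W, linear (fun v : V => v ⊗ w)) /\
  (forall v : V, linear (fun w : W => v ⊗ w)).
Proof.
split=> [w|v] a x y; apply/matrixP=> i j; rewrite !mxE linearP /=.
  by rewrite mulrDl mulrA.
by rewrite mulrDr mulrCA.
Qed.

Lemma tliftE (f : V -> W -> U) v w :
  (forall w, linear (f^~ w)) -> (forall v, linear (f v)) ->
  \sw_(a, b <- v ⊗ w) f a b = f v w.
Proof.
move=> fl fr.
have lin_sum (X : vectType k) (g : X -> U) n (c : 'I_n -> k) (x : 'I_n -> X) :
    linear g -> g (\sum_i c i *: x i) = \sum_i c i *: g (x i).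
  move=> lg; pose G : {linear X -> U} :=
    HB.pack g (GRing.isSemilinear.Build k X U _ g (GRing.semilinear_linear lg)).
  by rewrite -[g]/(G : X -> U) linear_sum; apply: eq_bigr => i _; rewrite linearZ.
rewrite [in RHS](coord_vbasis (memvf v)) (lin_sum _ (f^~ w)) //.
apply: eq_bigr => i _.
rewrite [in RHS](coord_vbasis (memvf w)) lin_sum // scaler_sumr.
by apply: eq_bigr => j _; rewrite mxE scalerA.
Qed.

Lemma tens_span (t : tensor V W) : t = \sw_(a, b <- t) (a ⊗ b).
Proof.
apply/matrixP=> i j; rewrite /tlift summxE (bigD1 i) //= summxE (bigD1 j) //=.
have freeb (X : vectType k) := basis_free (vbasisP {: X}).
rewrite !mxE !coord_free ?freeb // !eqxx !mulr1 !big1 ?addr0 // => [i' i'i|j' j'j].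
  rewrite summxE big1 // => j' _.
  by rewrite !mxE !coord_free ?freeb // (negbTE i'i) mul0r mulr0.
by rewrite !mxE !coord_free ?freeb // (negbTE j'j) !mulr0.
Qed.

Lemma tlift_param_linear (X : vectType k) (F : X -> V -> W -> U) t :
  (forall a b, linear (fun x => F x a b)) ->
  linear (fun x => \sw_(a, b <- t) F x a b).
Proof.
move=> lF c x y; rewrite /tlift scaler_sumr -big_split; apply: eq_bigr => i _.
rewrite scaler_sumr -big_split; apply: eq_bigr => j _ /=.
by rewrite lF scalerDr !scalerA mulrC.
Qed.

End TensorTheory.

Section Coalgebra.
Variables (k : fieldType) (C : vectType k).
Variables (Delta : C -> tensor C C) (eps : C -> k).

Record coalgebra_axioms : Prop := CoalgebraAxioms {
  coassoc : forall c,
    \sw_(a, b <- Delta c) \sw_(a1, a2 <- Delta a) (a1 ⊗ (a2 ⊗ b)) =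
    \sw_(a, b <- Delta c) \sw_(b1, b2 <- Delta b) (a ⊗ (b1 ⊗ b2));
  counitl : forall c, \sw_(a, b <- Delta c) (eps a *: b) = c;
  counitr : forall c, \sw_(a, b <- Delta c) (eps b *: a) = c
}.

(* Delta maps D into (the image in C ⊗ C of) D ⊗ D. *)
Definition subcoalgebra (D : {vspace C}) : Prop :=
  forall d, d \in D ->
  exists t : tensor (subvs_of D) (subvs_of D),
    Delta d = \sw_(a, b <- t) (vsval a ⊗ vsval b).

(* The comultiplication of the subcoalgebra D, as a map D -> D ⊗ D. *)
Definition sub_coprod (D : {vspace C}) (d : subvs_of D) :
    tensor (subvs_of D) (subvs_of D) :=
  \sw_(a, b <- Delta (vsval d)) (vsproj D a ⊗ vsproj D b).

(* M □_C N, for a right comodule M and a left comodule N. *)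
Definition cotensor (M N : vectType k)
    (rhoM : M -> tensor M C) (rhoN : N -> tensor C N) : {vspace tensor M N} :=
  (lker (linfun (fun t : tensor M N => \sw_(m, n <- t) (m ⊗ rhoN n))
       - linfun (fun t : tensor M N =>
           \sw_(m, n <- t) \sw_(m0, c <- rhoM m) (m0 ⊗ (c ⊗ n)))))%R.

Lemma mem_cotensor (M N : vectType k)
    (rhoM : M -> tensor M C) (rhoN : N -> tensor C N) t :
  t \in cotensor rhoM rhoN <->
  \sw_(m, n <- t) (m ⊗ rhoN n) =
  \sw_(m, n <- t) \sw_(m0, c <- rhoM m) (m0 ⊗ (c ⊗ n)).
Proof.
rewrite memv_ker add_lfunE opp_lfunE subr_eq0.
rewrite (lfunE (tlift _)) (lfunE (tlift _)) /=.
by split=> /eqP.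
Qed.

End Coalgebra.

Section Dual.
Variables (k : fieldType) (V : vectType k).

Definition dual : vectType k := 'Hom(V, k^o).

Definition dual_vec (i : 'I_(\dim {: V})) : dual :=
  linfun (coord (vbasis {: V}) i : V -> k^o).

(* The right C-comodule V^* dual to a left C-comodule (V, rho); it is          *)
(* characterised by dual_coactE below.                                         *)
Definition dual_coact (C : vectType k) (rho : V -> tensor C V) (f : dual) :
    tensor dual C :=
  \sum_i dual_vec i ⊗ (\sw_(c, v <- rho (vbasis {: V})`_i) (f v *: c)).

Lemma dual_vecE i v : dual_vec i v = coord (vbasis {: V}) i v.
Proof. by rewrite lfunE. Qed.

Lemma dual_coactE (C : vectType k) (rho : {linear V -> tensor C V}) f v :
  \sw_(g, c <- dual_coact rho f) ((g : dual) v *: c) = \sw_(c, w <- rho v) (f w *: c).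
Proof.
rewrite linear_sum /= [in RHS](coord_vbasis (memvf v)) !linear_sum.
apply: eq_bigr => i _; rewrite !linearZ /= -dual_vecE.
rewrite (tliftE (f := fun (g : dual) c => g v *: c)) // => [c|g] a x y.
  by rewrite lfunE /= lfunE /= scalerDl -scalerA.
by rewrite scalerDr !scalerA mulrC.
Qed.

End Dual.

(* Algebra structures carried by a subspace A of a vector space. Algebras with *)
(* 1 = 0 must be allowed (D may be 0), which the library's algType excludes.   *)
Record algebra_axioms (k : fieldType) (V : vectType k) (A : {vspace V})
    (mul : V -> V -> V) (one : V) : Prop := AlgebraAxioms {
  alg_one : one \in A;
  alg_mul : {in A &, forall x y, mul x y \in A};
  alg_mulDl : forall c, {in A & &, forall x y z,
    mul (c *: x + y) z = c *: mul x z + mul y z};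
  alg_mulDr : forall c, {in A & &, forall z x y,
    mul z (c *: x + y) = c *: mul z x + mul z y};
  alg_mulA : {in A & &, forall x y z, mul x (mul y z) = mul (mul x y) z};
  alg_mul1l : {in A, forall x, mul one x = x};
  alg_mul1r : {in A, forall x, mul x one = x}
}.

Definition algebra_isomorphic (k : fieldType)
    (V : vectType k) (A : {vspace V}) (mulA : V -> V -> V) (oneA : V)
    (W : vectType k) (B : {vspace W}) (mulB : W -> W -> W) (oneB : W) : Prop :=
  [/\ algebra_axioms A mulA oneA,
      algebra_axioms B mulB oneB
    & exists phi : 'Hom(V, W),
        [/\ (A :&: lker phi = 0)%VS, (phi @: A = B)%VS,
            {in A &, forall x y, phi (mulA x y) = mulB (phi x) (phi y)}
          & phi oneA = oneB]].

(* The regular left module is completely reducible. *)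
Definition semisimple (k : fieldType) (A : falgType k) : Prop :=
  let left_ideal (I : {vspace A}) := forall a x, x \in I -> a * x \in I in
  forall I, left_ideal I ->
  exists J, [/\ left_ideal J, (I + J = fullv)%VS & (I :&: J = 0)%VS].

Definition tensor_mul (k : fieldType) (A B : vectType k)
    (mulA : A -> A -> A) (mulB : B -> B -> B) (s t : tensor A B) : tensor A B :=
  \sw_(a, b <- s) \sw_(a', b' <- t) (mulA a a' ⊗ mulB b b').

Section TensorPowers.
Variables (k : fieldType) (H : falgType k).

Definition mul2 : tensor H H -> tensor H H -> tensor H H :=
  tensor_mul *%R *%R.
Definition mul3 :
    tensor H (tensor H H) -> tensor H (tensor H H) -> tensor H (tensor H H) :=
  tensor_mul *%R mul2.

Definition leg12 (R : tensor H H) : tensor H (tensor H H) :=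
  \sw_(r1, r2 <- R) (r1 ⊗ (r2 ⊗ (1 : H))).
Definition leg13 (R : tensor H H) : tensor H (tensor H H) :=
  \sw_(r1, r2 <- R) (r1 ⊗ ((1 : H) ⊗ r2)).
Definition leg23 (R : tensor H H) : tensor H (tensor H H) :=
  (1 : H) ⊗ R.

End TensorPowers.

(* falgType: H is finite-dimensional. This is no restriction below, since a    *)
(* semisimple Hopf algebra over a field is finite-dimensional (Sweedler).      *)
Record hopf_algebra (k : fieldType) (H : falgType k) := HopfAlgebra {
  coprod : {linear H -> tensor H H};
  counit : {linear H -> k^o};
  antipode : {linear H -> H};
  hopf_coalgebra : coalgebra_axioms coprod counit;
  coprod1 : coprod 1 = 1 ⊗ 1;
  coprodM : forall x y, coprod (x * y) = mul2 (coprod x) (coprod y);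
  counit1 : counit 1 = 1;
  counitM : forall x y, counit (x * y) = counit x * counit y;
  antipodel : forall h, \sw_(a, b <- coprod h) (antipode a * b) = counit h *: 1;
  antipoder : forall h, \sw_(a, b <- coprod h) (a * antipode b) = counit h *: 1
}.

Record quasi_triangular (k : fieldType) (H : falgType k) (hH : hopf_algebra H)
    (R : tensor H H) : Prop := QuasiTriangular {
  qt_invertible : exists R', mul2 R R' = 1 ⊗ 1 /\ mul2 R' R = 1 ⊗ 1;
  qt_coprod : forall h,
    \sw_(r1, r2 <- R) \sw_(h1, h2 <- coprod hH h) ((r1 * h1) ⊗ (r2 * h2)) =
    \sw_(r1, r2 <- R) \sw_(h1, h2 <- coprod hH h) ((h2 * r1) ⊗ (h1 * r2));
  qt_coprodl :
    \sw_(r1, r2 <- R) \sw_(a, b <- coprod hH r1) (a ⊗ (b ⊗ r2)) =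
    mul3 (leg13 R) (leg23 R);
  qt_coprodr :
    \sw_(r1, r2 <- R) (r1 ⊗ coprod hH r2) = mul3 (leg13 R) (leg12 R)
}.

Section Transmutation.
Variables (k : fieldType) (H : falgType k) (hH : hopf_algebra H).
Variable (R : tensor H H).

Local Notation Delta := (coprod hH).
Local Notation eps := (counit hH).
Local Notation S := (antipode hH).

Definition ad (h x : H) : H := \sw_(a, b <- Delta h) (a * x * S b).

Definition coprodR (h : H) : tensor H H :=
  \sw_(a, b <- Delta h) \sw_(r1, r2 <- R) ((a * S r2) ⊗ ad r1 b).

Definition module_subcoalgebra (D : {vspace H}) : Prop :=
  subcoalgebra coprodR D /\ (forall h d, d \in D -> ad h d \in D).

Lemma ad_is_linear h : linear (ad h).
Proof.
by apply: tlift_param_linear => a b c x y;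
  rewrite mulrDr mulrDl -scalerAr -scalerAl.
Qed.
HB.instance Definition _ h := GRing.isSemilinear.Build k H H _ (ad h)
  (GRing.semilinear_linear (ad_is_linear h)).

Lemma coprodR_is_linear : linear coprodR.
Proof. by move=> c x y; rewrite /coprodR !linearP. Qed.
HB.instance Definition _ := GRing.isSemilinear.Build k H (tensor H H) _ coprodR
  (GRing.semilinear_linear coprodR_is_linear).

Variable (D : {vspace H}).
Local Notation Dt := (subvs_of D).
Local Notation Dual := (dual Dt).
Local Notation DeltaD := (sub_coprod coprodR (D := D)).

Definition adD (h : H) (d : Dt) : Dt := vsproj D (ad h (vsval d)).

Lemma DeltaD_is_linear : linear DeltaD.
Proof. by move=> c x y; rewrite /sub_coprod !linearP. Qed.
HB.instance Definition _ :=
  GRing.isSemilinear.Build k Dt (tensor Dt Dt) _ DeltaD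
    (GRing.semilinear_linear DeltaD_is_linear).

Lemma adD_is_linear h : linear (adD h).
Proof. by move=> c x y; rewrite /adD !linearP. Qed.
HB.instance Definition _ h := GRing.isSemilinear.Build k Dt Dt _ (adD h)
  (GRing.semilinear_linear (adD_is_linear h)).

(* D as a left H_R-comodule, and the left H_R-coaction on H ⊗ D. *)
Definition coactD (d : Dt) : tensor H Dt :=
  \sw_(a, b <- DeltaD d) (vsval a ⊗ b).

Definition coactHD (t : tensor H Dt) : tensor H (tensor H Dt) :=
  \sw_(h, d <- t) \sw_(h1, h2 <- Delta h) \sw_(d1, d2 <- DeltaD d)
    (ad h1 (vsval d1) ⊗ (h2 ⊗ d2)).

Definition N_space : {vspace tensor Dual (tensor H Dt)} :=
  cotensor (dual_coact coactD) coactHD.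

(* For x = sum_j w_j^* ⊗ h_j ⊗ w_j and y = sum_l v_l^* ⊗ g_l ⊗ v_l,           *)
(* x o y = sum_(l, j) v_l^* ⊗ g_l h_j ⊗ <w_j^*, v_l> w_j.                      *)
Definition N_mul (x y : tensor Dual (tensor H Dt)) : tensor Dual (tensor H Dt) :=
  \sw_(w', hw <- x) \sw_(h, w <- hw) \sw_(v', gv <- y) \sw_(g, v <- gv)
    (v' ⊗ ((g * h) ⊗ ((w' : Dual) v *: w))).

(* Under D^* ⊗ D = End(D), the element id_D, with 1 in the middle factor. *)
Definition N_one : tensor Dual (tensor H Dt) :=
  \sum_i dual_vec i ⊗ ((1 : H) ⊗ (vbasis {: Dt})`_i).

Definition convR (f f' : Dual) : Dual :=
  linfun (fun d => \sw_(a, b <- DeltaD d) (f a * f' b : k^o)).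

Definition dual_act (f : Dual) (h : H) : Dual :=
  linfun (fun d => f (adD h d)).

Definition epsD : Dual := linfun (fun d : Dt => eps (vsval d)).

(* The product of D^* # H^op, on the space D^* ⊗ H. *)
Definition smash_mul (x y : tensor Dual H) : tensor Dual H :=
  \sw_(f, h <- x) \sw_(f', h' <- y) \sw_(h1, h2 <- Delta h)
    (convR f (dual_act f' h1) ⊗ (h' * h2)).

Definition smash_one : tensor Dual H := epsD ⊗ (1 : H).

Lemma convRE f f' d :
  convR f f' d = \sw_(a, b <- DeltaD d) (f a * f' b : k^o).
Proof.
pose F : {linear Dt -> k^o} :=
  tlift (fun a b => f a * f' b : k^o) \o DeltaD.
exact: (lfunE F).
Qed.

Lemma dual_actE f h d : dual_act f h d = f (adD h d).
Proof. exact: (lfunE (f \o adD h : {linear Dt -> k^o})). Qed.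

Lemma epsDE d : epsD d = eps (vsval d).
Proof. exact: (lfunE (eps \o vsval : {linear Dt -> k^o})). Qed.

End Transmutation.

(* Main.v *)
From HB Require Import structures.
Require Import Defs.
From mathcomp Require Import all_boot all_order all_algebra all_field.

Set Implicit Arguments.
Unset Strict Implicit.
Unset Printing Implicit Defensive.

Import GRing.Theory.
Local Open Scope ring_scope.

(** Under D^* ⊗ X = Hom(D, X), an element of N_D is an H_R-colinear map
    phi : D -> H ⊗ D, and x ∘ y is composition: apply y, apply x to the
    D-component, multiply the H-components. Call such maps Kleisli maps.

    The coproduct Delta_R is H-linear for the adjoint action, and this makes
    H ⊗ D cofree: h ⊗ d |-> h_(1).d ⊗ h_(2) is a comodule isomorphism from
    H ⊗ D onto D ⊗ H with its coaction through D. A colinear map out of D is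
    then determined by the linear map (id ⊗ eps) phi : D -> H, so N_D has the
    same size as D^* ⊗ H.

    Inside N_D there is a copy of D^*, by f |-> (d |-> 1 ⊗ d^(1) f(d^(2))),
    and a copy of H^op, by h |-> beta(h) = (d |-> S^2(h_(2)) ⊗ S(h_(1)).d).
    The untwisted copy d |-> h_(2) ⊗ S^-1(h_(1)).d is also colinear, but
    commuting it past f produces f ◁ S^-2(h_(1)); composing it with the Hopf
    automorphism S^2 gives exactly the relation
    beta(h) ∘ f = (f ◁ h_(1)) ∘ beta(h_(2)) of the smash product. Hence
    f # h |-> f ∘ beta(h) is an algebra map D^* # H^op -> N_D; it is
    smash_map below, and smash_map_mul and smash_map_comodule_map say that it is
    multiplicative and lands in N_D.

    It is bijective as soon as S is. Composed with (id ⊗ eps) it is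
    f # h |-> (f ◁ S(h_(1))) ⊗ S^2(h_(2)), which an antipode computation inverts
    (counit_part_smash_inj), while (id ⊗ eps) is injective on N_D
    (counit_part_inj); an injective endomorphism of the finite-dimensional
    space D^* ⊗ H is onto, so the image is all of N_D.

    Three facts on quasi-triangular Hopf algebras remain: Delta_R is H-linear
    (sw_coprodR_ad), it is coassociative (sw_coprodR_coassoc), and S is bijective
    (antipode_bij), the last from the Drinfeld element u = S(R^2) R^1, which
    satisfies S^2(h) u = u h and has a left inverse.

    The algebra axioms need no separate computation for the smash product: they
    are pulled back along the injective multiplicative map from those of N_D,
    where they are the associativity and unit laws of Kleisli composition. In the
    other direction, N_D is closed under the product because it is an image. *)

(** * Multilinearity of Sweedler expressions *)

(** Sweedler sums are sums over coordinates, so every manipulation of them by a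
    Hopf algebra axiom has a multilinearity side condition on the summand. These
    predicates on bare functions let the tactic lin discharge it by following the
    syntax of the summand. *)
Definition islin (k : fieldType) (V W : vectType k) (f : V -> W) : Prop :=
  linear f.
Definition bilin (k : fieldType) (V1 V2 W : vectType k) (f : V1 -> V2 -> W) :=
  (forall b, islin (fun a => f a b)) /\ (forall a, islin (fun b => f a b)).
Definition trilin (k : fieldType) (V1 V2 V3 W : vectType k)
    (f : V1 -> V2 -> V3 -> W) :=
  [/\ forall b c, islin (fun a => f a b c), forall a c, islin (fun b => f a b c)
    & forall a b, islin (fun c => f a b c)].

Section Islin.
Variable k : fieldType.
Implicit Types (U V W X : vectType k) (H : falgType k).

Lemma lin_id V : islin (fun x : V => x). Proof. by []. Qed.

Lemma lin_sum V W (f : V -> W) I (r : seq I) (F : I -> V) :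
  islin f -> f (\sum_(i <- r) F i) = \sum_(i <- r) f (F i).
Proof.
move=> lf; pose g : {linear V -> W} :=
  HB.pack f (GRing.isSemilinear.Build k V W _ f (GRing.semilinear_linear lf)).
exact: (linear_sum g).
Qed.

Lemma linZ V W (f : V -> W) c v : islin f -> f (c *: v) = c *: f v.
Proof.
move=> lf; pose g : {linear V -> W} :=
  HB.pack f (GRing.isSemilinear.Build k V W _ f (GRing.semilinear_linear lf)).
exact: (linearZ_LR g).
Qed.

Lemma lin_comp U V W (g : V -> W) (f : U -> V) :
  islin g -> islin f -> islin (fun x => g (f x)).
Proof. by move=> lg lf c x y; rewrite lf lg. Qed.

Lemma lin_linear U V W (g : {linear V -> W}) (f : U -> V) :
  islin f -> islin (fun x => g (f x)).
Proof. by apply: lin_comp => c x y; rewrite linearP. Qed.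

Lemma lin_lfun U V W (g : 'Hom(V, W)) (f : U -> V) :
  islin f -> islin (fun x => g (f x)).
Proof. by apply: lin_comp => c x y; rewrite linearP. Qed.

Lemma lin_dual_app U V (f : U -> dual V) v :
  islin f -> islin (fun x => f x v : k^o).
Proof. by move=> lf c x y; rewrite lf !lfunE /= lfunE. Qed.

Lemma lin_mull U H (f : U -> H) c : islin f -> islin (fun x => f x * c).
Proof. by move=> lf a x y; rewrite lf mulrDl scalerAl. Qed.
Lemma lin_mulr U H (f : U -> H) c : islin f -> islin (fun x => c * f x).
Proof. by move=> lf a x y; rewrite lf mulrDr scalerAr. Qed.

Lemma lin_scalel U V (f : U -> k^o) (v : V) :
  islin f -> islin (fun x => f x *: v).
Proof. by move=> lf a x y; rewrite lf scalerDl scalerA. Qed.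
Lemma lin_scaler U V (f : U -> V) c : islin f -> islin (fun x => c *: f x).
Proof. by move=> lf a x y; rewrite lf scalerDr !scalerA mulrC. Qed.

Lemma lin_tensl U V W (f : U -> V) (w : W) : islin f -> islin (fun x => f x ⊗ w).
Proof. by move=> lf a x y; rewrite lf (tens_bilinear V W).1. Qed.
Lemma lin_tensr U V W (f : U -> W) (v : V) : islin f -> islin (fun x => v ⊗ f x).
Proof. by move=> lf a x y; rewrite lf (tens_bilinear V W).2. Qed.

Lemma lin_sw U V W X (F : U -> V -> W -> X) t :
  (forall a b, islin (fun x => F x a b)) ->
  islin (fun x => \sw_(a, b <- t) F x a b).
Proof. exact: tlift_param_linear. Qed.

Lemma lin_swt U V W X (F : V -> W -> X) (t : U -> tensor V W) :
  islin t -> islin (fun x => \sw_(a, b <- t x) F a b).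
Proof. by move=> lt a x y; rewrite lt linearP. Qed.

Lemma bilin_l U V1 V2 W (F : V1 -> V2 -> W) (f : U -> V1) b :
  bilin F -> islin f -> islin (fun x => F (f x) b).
Proof. by case=> l _ lf c x y; rewrite lf l. Qed.
Lemma bilin_r U V1 V2 W (F : V1 -> V2 -> W) (f : U -> V2) a :
  bilin F -> islin f -> islin (fun x => F a (f x)).
Proof. by case=> _ l lf c x y; rewrite lf l. Qed.
Lemma trilin_1 U V1 V2 V3 W (F : V1 -> V2 -> V3 -> W) (f : U -> V1) b c :
  trilin F -> islin f -> islin (fun x => F (f x) b c).
Proof. by case=> l _ _ lf e x y; rewrite lf l. Qed.
Lemma trilin_2 U V1 V2 V3 W (F : V1 -> V2 -> V3 -> W) (f : U -> V2) a c :
  trilin F -> islin f -> islin (fun x => F a (f x) c).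
Proof. by case=> _ l _ lf e x y; rewrite lf l. Qed.
Lemma trilin_3 U V1 V2 V3 W (F : V1 -> V2 -> V3 -> W) (f : U -> V3) a b :
  trilin F -> islin f -> islin (fun x => F a b (f x)).
Proof. by case=> _ _ l lf e x y; rewrite lf l. Qed.

Lemma lin_hom V W (f : V -> W) :
  islin f -> exists F : 'Hom(V, W), F =1 f.
Proof.
move=> L; pose g : {linear V -> W} :=
  HB.pack f (GRing.isSemilinear.Build k V W _ f (GRing.semilinear_linear L)).
by exists (linfun g) => x; rewrite lfunE.
Qed.

Lemma lin_inj_surj V (f : V -> V) :
  islin f -> injective f -> forall y, exists x, f x = y.
Proof.
move=> /lin_hom[F FE] f_inj y; exists ((F^-1)%VF y).
rewrite -FE lker0_lfunVK //; apply/lker0P => a b; rewrite !FE; exact: f_inj.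
Qed.

End Islin.

Section AdLin.
Variables (k : fieldType) (H : falgType k) (hH : hopf_algebra H).
Variable D : {vspace H}.
Implicit Type U : vectType k.

Lemma lin_adl U (f : U -> H) x : islin f -> islin (fun h => ad hH (f h) x).
Proof. by move=> lf; apply: lin_swt; apply: lin_linear. Qed.
Lemma lin_adr U (f : U -> H) h : islin f -> islin (fun x => ad hH h (f x)).
Proof. by apply: lin_comp => c x y; rewrite linearP. Qed.
Lemma lin_adDl U (f : U -> H) (x : subvs_of D) :
  islin f -> islin (fun h => adD hH (f h) x).
Proof. by move=> lf; apply: lin_linear; apply: lin_adl. Qed.
Lemma lin_adDr U (f : U -> subvs_of D) h : islin f -> islin (fun x => adD hH h (f x)).
Proof. by apply: lin_comp => c x y; rewrite linearP. Qed.

End AdLin.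

(** The map V -> W attached to an element of V^* ⊗ W. *)
Definition ev (k : fieldType) (V W : vectType k) (t : tensor (dual V) W) (v : V) : W :=
  \sw_(f, w <- t) ((f : dual V) v *: w).

Section EvLin.
Variables (k : fieldType) (V W U : vectType k).

Lemma lin_evl (f : U -> tensor (dual V) W) v :
  islin f -> islin (fun x => ev (f x) v).
Proof. exact: lin_swt. Qed.

Lemma lin_evr (f : U -> V) (t : tensor (dual V) W) :
  islin f -> islin (fun x => ev t (f x)).
Proof.
move=> lf; apply: lin_sw => g w.
by apply: lin_scalel; apply: (@lin_lfun _ _ _ k^o).
Qed.

Variables (H : falgType k) (hH : hopf_algebra H) (D : {vspace H}).

Lemma lin_dual_actl (f : U -> dual (subvs_of D)) h :
  islin f -> islin (fun x => dual_act hH (f x) h).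
Proof.
by move=> lf c x y; apply/lfunP => d; rewrite
  dual_actE lf !lfunE /= !lfunE /= !dual_actE.
Qed.

Lemma lin_dual_actr (h : U -> H) (f : dual (subvs_of D)) :
  islin h -> islin (fun x => dual_act hH f (h x)).
Proof.
move=> lh c x y; apply/lfunP => d; rewrite !lfunE /= !lfunE /= !dual_actE.
by rewrite (lin_adDl hH d lh) linearP.
Qed.

End EvLin.

(** Bound variables of a Sweedler sum occur exactly once in its summand, so it is
    enough to find, at each node of the term, the argument that contains the
    variable. *)
Ltac lin :=
  intros;
  (* Unification may have eta-contracted the function, which would hide its head
     symbol from the patterns below. *)
  try match goal with
    |- @islin ?k ?V ?W ?f => change (@islin k V W (fun x => f x))
  end;
  cbv beta;
  first
  [ apply: lin_id
  | match goal with
    | L : bilin ?F |- islin (fun x => ?F _ _) =>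
      first [apply: (bilin_l _ L); lin | apply: (bilin_r _ L); lin]
    | L : trilin ?F |- islin (fun x => ?F _ _ _) =>
      first [apply: (trilin_1 _ _ L); lin | apply: (trilin_2 _ _ L); lin
            | apply: (trilin_3 _ _ L); lin]
    | L : islin ?f |- islin (fun x => ?f _) => apply: (lin_comp L); lin
    | |- islin (fun x => tlift (fun _ _ => _) _) =>
      first [apply: lin_sw; lin | apply: lin_swt; lin]
    | |- islin (fun x => GRing.mul _ _) =>
      first [apply: lin_mull; lin | apply: lin_mulr; lin]
    | |- islin (fun x => GRing.scale _ _) =>
      first [apply: lin_scaler; lin | apply: lin_scalel; lin]
    | |- islin (fun x => tens _ _) =>
      first [apply: lin_tensl; lin | apply: lin_tensr; lin]
    | |- islin (fun x => ad _ _ _) =>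
      first [apply: lin_adl; lin | apply: lin_adr; lin]
    | |- islin (fun x => adD _ _ _) =>
      first [apply: lin_adDl; lin | apply: lin_adDr; lin]
    | |- islin (fun x => ev _ _) =>
      first [apply: lin_evl; lin | apply: lin_evr; lin]
    | |- islin (fun x => dual_act _ _ _) =>
      first [apply: lin_dual_actl; lin | apply: lin_dual_actr; lin]
    | |- islin (fun x => fun_of_lfun _ _) =>
      first [apply: lin_lfun; lin | apply: lin_dual_app; lin]
    | |- islin _ => apply: lin_linear; lin
    | |- bilin _ => split; lin
    | |- trilin _ => split; lin
    end ].

#[local] Hint Extern 0 (islin _) => solve [lin] : core.
#[local] Hint Extern 0 (bilin _) => solve [lin] : core.
#[local] Hint Extern 0 (trilin _) => solve [lin] : core.

(** * Sweedler sums *)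

Section Sw.
Variables (k : fieldType).
Implicit Types (U V W X : vectType k).

Lemma eq_sw V W X (F G : V -> W -> X) t :
  (forall a b, F a b = G a b) -> \sw_(a, b <- t) F a b = \sw_(a, b <- t) G a b.
Proof. by move=> e; apply: eq_bigr => i _; apply: eq_bigr => j _; rewrite e. Qed.

Lemma lin_tlift V W X U (f : X -> U) (F : V -> W -> X) t :
  islin f -> f (\sw_(a, b <- t) F a b) = \sw_(a, b <- t) f (F a b).
Proof.
move=> lf; rewrite /tlift lin_sum //; apply: eq_bigr => i _.
by rewrite lin_sum //; apply: eq_bigr => j _; rewrite linZ.
Qed.

Lemma sw_tens V W X (F : V -> W -> X) v w :
  bilin F -> \sw_(a, b <- v ⊗ w) F a b = F v w.
Proof. by case=> l r; apply: tliftE. Qed.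

Lemma sw_exch V W V' W' X (F : V -> W -> V' -> W' -> X) s t :
  \sw_(a, b <- s) \sw_(c, d <- t) F a b c d =
  \sw_(c, d <- t) \sw_(a, b <- s) F a b c d.
Proof.
have sw_sum n (G : 'I_n -> V' -> W' -> X) :
    \sum_i \sw_(c, d <- t) G i c d = \sw_(c, d <- t) \sum_i G i c d.
  rewrite /tlift exchange_big; apply: eq_bigr => i' _.
  by rewrite exchange_big; apply: eq_bigr => j' _; rewrite scaler_sumr.
rewrite {1}/tlift -sw_sum; apply: eq_bigr => i _; rewrite -sw_sum.
by apply: eq_bigr => j _; rewrite (lin_tlift (f := *:%R (s i j))).
Qed.

Lemma sw_sw V W V' W' X (G : V' -> W' -> tensor V W) (F : V -> W -> X) t :
  \sw_(a, b <- \sw_(c, d <- t) G c d) F a b =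
  \sw_(c, d <- t) \sw_(a, b <- G c d) F a b.
Proof. exact: (@lin_tlift _ _ _ _ (tlift F)). Qed.

End Sw.

(** * The antipode of a Hopf algebra *)

Section Hopf.
Variables (k : fieldType) (H : falgType k) (hH : hopf_algebra H).
Implicit Type X : vectType k.
Local Notation Delta := (coprod hH).
Local Notation eps := (counit hH).
Local Notation S := (antipode hH).

(** The axioms are equations in tensor powers of H; from here on they are used in
    the form obtained by applying a multilinear map to both sides. *)
Lemma sw_coassoc X (F : H -> H -> H -> X) h : trilin F ->
  \sw_(a, b <- Delta h) \sw_(a1, a2 <- Delta a) F a1 a2 b =
  \sw_(a, b <- Delta h) \sw_(b1, b2 <- Delta b) F a b1 b2.
Proof.
move=> L; pose G := tlift (fun a t => \sw_(b, c <- t) F a b c).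
have GE a b c : G (a ⊗ (b ⊗ c)) = F a b c by rewrite /G sw_tens // sw_tens.
have := congr1 G (coassoc (hopf_coalgebra hH) h).
rewrite !lin_tlift //.
under eq_sw => a b do (rewrite lin_tlift //; under eq_sw => c d do rewrite GE).
under [RHS]eq_sw => a b do (rewrite lin_tlift //; under eq_sw => c d do rewrite GE).
by [].
Qed.

Lemma sw_counitl X (F : H -> X) h :
  islin F -> \sw_(a, b <- Delta h) (eps a *: F b) = F h.
Proof.
move=> L; rewrite -[in RHS](counitl (hopf_coalgebra hH) h) lin_tlift //.
by apply: eq_sw => a b; rewrite linZ.
Qed.

Lemma sw_counitr X (F : H -> X) h :
  islin F -> \sw_(a, b <- Delta h) (eps b *: F a) = F h.
Proof.
move=> L; rewrite -[in RHS](counitr (hopf_coalgebra hH) h) lin_tlift //.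
by apply: eq_sw => a b; rewrite linZ.
Qed.

Lemma sw_antipodel X (F : H -> X) h :
  islin F -> \sw_(a, b <- Delta h) F (S a * b) = eps h *: F 1.
Proof. by move=> L; rewrite -linZ // -(antipodel hH) lin_tlift. Qed.

Lemma sw_antipoder X (F : H -> X) h :
  islin F -> \sw_(a, b <- Delta h) F (a * S b) = eps h *: F 1.
Proof. by move=> L; rewrite -linZ // -(antipoder hH) lin_tlift. Qed.

Lemma sw_coprod1 X (F : H -> H -> X) :
  bilin F -> \sw_(a, b <- Delta 1) F a b = F 1 1.
Proof. by move=> L; rewrite coprod1 sw_tens. Qed.

Lemma sw_coprodM X (F : H -> H -> X) x y : bilin F ->
  \sw_(a, b <- Delta (x * y)) F a b =
  \sw_(x1, x2 <- Delta x) \sw_(y1, y2 <- Delta y) F (x1 * y1) (x2 * y2).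
Proof.
move=> L; rewrite coprodM /mul2 /tensor_mul sw_sw; apply: eq_sw => a b.
by rewrite sw_sw; apply: eq_sw => c d; rewrite sw_tens.
Qed.

Arguments sw_counitl {X} F {h}.
Arguments sw_counitr {X} F {h}.
Arguments sw_antipodel {X} F {h}.
Arguments sw_antipoder {X} F {h}.

Lemma antipode1 : S 1 = 1.
Proof.
have := antipodel hH 1.
by rewrite counit1 scale1r coprod1 sw_tens // mulr1.
Qed.

(** Both sides are convolution inverse to the product H ⊗ H -> H. The sum T below
    is S(x_(1) y_(1)) x_(2) y_(2) S(y_(3)) S(x_(3)): it collapses to S(x y) when
    the factors on the right cancel, and to S(y) S(x) when the ones on the left
    do. *)
Lemma antipodeM (x y : H) : S (x * y) = S y * S x.
Proof.
pose T := \sw_(x1, x2 <- Delta x) \sw_(x3, x4 <- Delta x2)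
  \sw_(y1, y2 <- Delta y) \sw_(y3, y4 <- Delta y2)
    (S (x1 * y1) * (x3 * (y3 * S y4) * S x4)).
have T1 : T = S (x * y).
  rewrite -(sw_counitr (fun x1 => S (x1 * y))) //; apply: eq_sw => x1 x2.
  transitivity (\sw_(x3, x4 <- Delta x2) (S (x1 * y) * (x3 * S x4))).
    apply: eq_sw => x3 x4.
    rewrite -(sw_counitr (fun y1 => S (x1 * y1) * (x3 * S x4))) //.
    apply: eq_sw => y1 y2.
    by rewrite (sw_antipoder (fun z => S (x1 * y1) * (x3 * z * S x4))) ?mulr1.
  by rewrite (sw_antipoder (fun z => S (x1 * y) * z)) ?mulr1.
rewrite -{}T1 /T -sw_coassoc //.
rewrite -[in RHS](sw_counitl (fun z => S y * S z)) //; apply: eq_sw => x' x4.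
under eq_sw => x1 x3 do rewrite -sw_coassoc //.
rewrite sw_exch.
rewrite -[in RHS](sw_counitl (fun z => S z * S x4)) //.
rewrite lin_tlift //; apply: eq_sw => y' y4.
rewrite scalerA -[_ * _](counitM hH).
transitivity (\sw_(a, b <- Delta (x' * y')) (S a * b * (S y4 * S x4))).
  rewrite sw_coprodM //; apply: eq_sw => x1 x3; apply: eq_sw => y1 y3.
  by rewrite !mulrA.
by rewrite (sw_antipodel (fun z => z * (S y4 * S x4))) ?mul1r.
Qed.

Lemma counit_antipode h : eps (S h) = eps h.
Proof.
have <- : eps (\sw_(a, b <- Delta h) (S a * b)) = eps h.
  by rewrite antipodel linearZ /= counit1 [LHS]mulr1.
rewrite lin_tlift // -(sw_counitr (fun z => eps (S z))) //.
by apply: eq_sw => a b; rewrite counitM mulrC.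
Qed.

(** (h_(1) ⊗ h_(2)) (S(h_(4)) ⊗ S(h_(3))) = eps(h) 1 ⊗ 1, that is, the map
    h |-> S(h_(2)) ⊗ S(h_(1)) is a right convolution inverse of Delta. *)
Lemma sw_antipode_mid X (G : H -> H -> X) u : bilin G ->
  \sw_(v, w <- Delta u) \sw_(a, b <- Delta v) \sw_(c, d <- Delta w)
    G (a * S d) (b * S c) = eps u *: G 1 1.
Proof.
move=> L; rewrite sw_coassoc // -(sw_antipoder (fun z => G z 1)) //.
apply: eq_sw => a w; rewrite -sw_coassoc //.
rewrite -(sw_counitl (fun z => G (a * S z) 1)) //; apply: eq_sw => z d.
by rewrite (sw_antipoder (fun y => G (a * S d) y)).
Qed.

(** Delta o S and h |-> S(h_(2)) ⊗ S(h_(1)) are a left and a right convolution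
    inverse of Delta; T is their product with Delta in the middle. *)
Lemma sw_coprod_antipode X (F : H -> H -> X) h : bilin F ->
  \sw_(a, b <- Delta (S h)) F a b = \sw_(a, b <- Delta h) F (S b) (S a).
Proof.
move=> L; pose T := \sw_(x, u <- Delta h) \sw_(v, w <- Delta u)
  \sw_(p, q <- Delta (S x)) \sw_(a, b <- Delta v) \sw_(c, d <- Delta w)
    F (p * (a * S d)) (q * (b * S c)).
transitivity T.
  rewrite -(sw_counitr (fun x => \sw_(a, b <- Delta (S x)) F a b)) //.
  apply: eq_sw => x u; rewrite sw_exch lin_tlift //.
  apply: eq_sw => p q.
  by rewrite (@sw_antipode_mid _ (fun y z => F (p * y) (q * z))) ?mulr1.
rewrite /T -sw_coassoc //.
rewrite -[RHS](sw_counitl (fun w => \sw_(a, b <- Delta w) F (S b) (S a))) //.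
apply: eq_sw => y w.
under eq_sw => x v do (under eq_sw => p q do rewrite sw_exch; rewrite sw_exch).
rewrite sw_exch lin_tlift //; apply: eq_sw => c d.
transitivity (\sw_(x, v <- Delta y) \sw_(p, q <- Delta (S x * v))
  F (p * S d) (q * S c)).
  apply: eq_sw => x v; rewrite sw_coprodM //; apply: eq_sw => p q.
  by apply: eq_sw => a b; rewrite !mulrA.
rewrite (sw_antipodel (fun z => \sw_(p, q <- Delta z) F (p * S d) (q * S c))) //.
by rewrite sw_coprod1 ?mul1r.
Qed.

Lemma sw_antipode_sq X (F : H -> H -> X) h : bilin F ->
  \sw_(a, b <- Delta (S (S h))) F a b = \sw_(a, b <- Delta h) F (S (S a)) (S (S b)).
Proof. by move=> L; rewrite !sw_coprod_antipode. Qed.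

Lemma ad1 x : ad hH 1 x = x.
Proof. by rewrite /ad sw_coprod1 // antipode1 mul1r mulr1. Qed.

Lemma adM (g h x : H) : ad hH (g * h) x = ad hH g (ad hH h x).
Proof.
rewrite /ad sw_coprodM //; apply: eq_sw => a b.
rewrite (lin_tlift (f := fun z => a * z * S b)) //; apply: eq_sw => c d.
by rewrite antipodeM !mulrA.
Qed.

Lemma counit_ad h x : eps (ad hH h x) = eps h * eps x.
Proof.
rewrite /ad lin_tlift // mulrC -[RHS](sw_counitl (fun z => eps x *: eps z)) //.
by apply: eq_sw => a b; rewrite !counitM counit_antipode -mulrA.
Qed.

End Hopf.

Arguments sw_counitl {k H hH X} F {h}.
Arguments sw_counitr {k H hH X} F {h}.
Arguments sw_antipodel {k H hH X} F {h}.
Arguments sw_antipoder {k H hH X} F {h}.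

(** * The R-matrix and the bijectivity of the antipode *)

Section Quasitriangular.
Variables (k : fieldType) (H : falgType k) (hH : hopf_algebra H) (R : tensor H H).
Hypothesis qt : quasi_triangular hH R.
Implicit Type X : vectType k.
Local Notation Delta := (coprod hH).
Local Notation eps := (counit hH).
Local Notation S := (antipode hH).

Lemma sw_mul2 X (F : H -> H -> X) s t : bilin F ->
  \sw_(a, b <- mul2 s t) F a b =
  \sw_(a, b <- s) \sw_(c, d <- t) F (a * c) (b * d).
Proof.
move=> L; rewrite /mul2 /tensor_mul sw_sw; apply: eq_sw => a b.
by rewrite sw_sw; apply: eq_sw => c d; rewrite sw_tens.
Qed.

Lemma sw_qt X (F : H -> H -> X) h : bilin F ->
  \sw_(r1, r2 <- R) \sw_(a, b <- Delta h) F (r1 * a) (r2 * b) =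
  \sw_(r1, r2 <- R) \sw_(a, b <- Delta h) F (b * r1) (a * r2).
Proof.
move=> L; have := congr1 (tlift F) (qt_coprod qt h).
rewrite !sw_sw => e; do [under eq_sw => a b do
  (rewrite sw_sw; under eq_sw => c d do rewrite sw_tens //)] in e.
rewrite {}e; apply: eq_sw => a b.
by rewrite sw_sw; apply: eq_sw => c d; rewrite sw_tens.
Qed.

Lemma sw_mul3 X (F : H -> H -> H -> X) s t : trilin F ->
  \sw_(a, bc <- mul3 s t) \sw_(b, c <- bc) F a b c =
  \sw_(a, bc <- s) \sw_(a', bc' <- t) \sw_(b, c <- bc) \sw_(b', c' <- bc')
    F (a * a') (b * b') (c * c').
Proof.
move=> L; rewrite /mul3 /tensor_mul sw_sw; apply: eq_sw => a bc.
by rewrite sw_sw; apply: eq_sw => a' bc'; rewrite sw_tens // sw_mul2.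
Qed.

Lemma sw_qt_l X (F : H -> H -> H -> X) : trilin F ->
  \sw_(r1, r2 <- R) \sw_(a, b <- Delta r1) F a b r2 =
  \sw_(r1, r2 <- R) \sw_(q1, q2 <- R) F r1 q1 (r2 * q2).
Proof.
move=> L; pose G t := \sw_(a, bc <- t) \sw_(b, c <- bc) F a b c.
transitivity (G (\sw_(r1, r2 <- R) \sw_(a, b <- Delta r1) (a ⊗ (b ⊗ r2)))).
  rewrite /G sw_sw; apply: eq_sw => r1 r2; rewrite sw_sw; apply: eq_sw => a b.
  by rewrite !sw_tens.
rewrite (qt_coprodl qt) /G sw_mul3 // /leg13 sw_sw; apply: eq_sw => r1 r2.
rewrite sw_tens // /leg23 sw_tens //= sw_tens //.
by apply: eq_sw => q1 q2; rewrite mulr1 mul1r.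
Qed.

Lemma sw_qt_r X (F : H -> H -> H -> X) : trilin F ->
  \sw_(r1, r2 <- R) \sw_(a, b <- Delta r2) F r1 a b =
  \sw_(r1, r2 <- R) \sw_(q1, q2 <- R) F (r1 * q1) q2 r2.
Proof.
move=> L; pose G t := \sw_(a, bc <- t) \sw_(b, c <- bc) F a b c.
transitivity (G (\sw_(r1, r2 <- R) (r1 ⊗ Delta r2))).
  by rewrite /G sw_sw; apply: eq_sw => r1 r2; rewrite sw_tens.
rewrite (qt_coprodr qt) /G sw_mul3 // /leg13 sw_sw; apply: eq_sw => r1 r2.
rewrite sw_tens // /leg12 sw_sw; apply: eq_sw => q1 q2.
by rewrite !sw_tens // mul1r mulr1.
Qed.

Lemma mul2A (r s t : tensor H H) : mul2 r (mul2 s t) = mul2 (mul2 r s) t.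
Proof.
rewrite {3}/mul2 /tensor_mul sw_mul2 // {1}/mul2 /tensor_mul.
apply: eq_sw => a b; rewrite sw_mul2 //; apply: eq_sw => c d.
by apply: eq_sw => e f; rewrite !mulrA.
Qed.

Lemma mul2_1l (t : tensor H H) : mul2 (1 ⊗ 1) t = t.
Proof.
rewrite /mul2 /tensor_mul sw_tens // [RHS]tens_span.
by apply: eq_sw => a b; rewrite !mul1r.
Qed.

Lemma mul2_1r (t : tensor H H) : mul2 t (1 ⊗ 1) = t.
Proof.
rewrite /mul2 /tensor_mul [RHS]tens_span; apply: eq_sw => a b.
by rewrite sw_tens // !mulr1.
Qed.

Lemma tens_inj1l (x : H) : x ⊗ (1 : H) = 1 ⊗ 1 -> x = 1.
Proof.
move/(congr1 (tlift (fun a b => eps b *: a))).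
by rewrite !sw_tens // counit1 !scale1r.
Qed.

Lemma tens_inj1r (x : H) : (1 : H) ⊗ x = 1 ⊗ 1 -> x = 1.
Proof.
move/(congr1 (tlift (fun a b => eps a *: b))).
by rewrite !sw_tens // counit1 !scale1r.
Qed.

(** Applying eps to the middle factor of (id ⊗ Delta) R = R^13 R^12 gives
    R = R (E ⊗ 1) for E the left-hand side; then cancel R. *)
Lemma R_counitr : \sw_(r1, r2 <- R) (eps r2 *: r1) = 1.
Proof.
set E := (LHS); have [R' [_ R'R]] := qt_invertible qt.
have RE : mul2 R (E ⊗ 1) = R.
  rewrite [RHS]tens_span /mul2 /tensor_mul.
  under [RHS]eq_sw => r1 r2 do rewrite -(sw_counitl (hH := hH) (fun z => r1 ⊗ z)) //.
  rewrite (sw_qt_r (F := fun a b c => eps b *: (a ⊗ c))) //.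
  apply: eq_sw => r1 r2; rewrite sw_tens // mulr1 /E.
  rewrite (lin_tlift (f := fun z => (r1 * z) ⊗ r2)) //.
  by apply: eq_sw => q1 q2; rewrite (linZ (f := fun z => (r1 * z) ⊗ r2)).
by apply: tens_inj1l; rewrite -[LHS]mul2_1l -R'R -mul2A RE.
Qed.

(** As R_counitr, with (Delta ⊗ id) R = R^13 R^23 and eps on the first factor. *)
Lemma R_counitl : \sw_(r1, r2 <- R) (eps r1 *: r2) = 1.
Proof.
set E := (LHS); have [R' [RR' _]] := qt_invertible qt.
have RE : mul2 (1 ⊗ E) R = R.
  rewrite [RHS]tens_span /mul2 /tensor_mul.
  under [RHS]eq_sw => r1 r2 do rewrite -(sw_counitl (hH := hH) (fun z => z ⊗ r2)) //.
  rewrite (sw_qt_l (F := fun a b c => eps a *: (b ⊗ c))) // sw_tens //.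
  rewrite [RHS]sw_exch; apply: eq_sw => q1 q2; rewrite mul1r /E.
  rewrite (lin_tlift (f := fun z => q1 ⊗ (z * q2))) //.
  by apply: eq_sw => r1 r2; rewrite (linZ (f := fun z => q1 ⊗ (z * q2))).
by apply: tens_inj1r; rewrite -[LHS]mul2_1r -RR' mul2A RE.
Qed.

Lemma sw_R_counitr X (F : H -> X) : islin F ->
  \sw_(r1, r2 <- R) (eps r2 *: F r1) = F 1.
Proof.
by move=> L; rewrite -R_counitr lin_tlift //; apply: eq_sw => a b; rewrite linZ.
Qed.

Lemma sw_R_counitl X (F : H -> X) : islin F ->
  \sw_(r1, r2 <- R) (eps r1 *: F r2) = F 1.
Proof.
by move=> L; rewrite -R_counitl lin_tlift //; apply: eq_sw => a b; rewrite linZ.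
Qed.

(** u = S(R^2) R^1 is the Drinfeld element. The relation S^2(h) u = u h follows from
    the commutation of R with Delta. The left inverse is v = R^2 S^2(R^1): moving u
    through S^2 turns v u into Q^2 S(R^2) R^1 Q^1, for Q a second copy of R, which is
    1 by (id ⊗ Delta) R = R^13 R^12 and the antipode axiom. A left inverse suffices
    for the injectivity of S, and it has a formula without S^-1. *)
Lemma antipode_sq_drinfeld : exists u v : H,
  v * u = 1 /\ forall h, S (S h) * u = u * h.
Proof.
pose u := \sw_(r1, r2 <- R) (S r2 * r1).
have uE h : S (S h) * u = u * h.
  pose T := \sw_(h', h3 <- Delta h) \sw_(r1, r2 <- R) \sw_(h1, h2 <- Delta h')
    (S (S h3) * S (r2 * h2) * (r1 * h1)).
  transitivity T.
    rewrite -(sw_counitl (hH := hH) (fun z => S (S z) * u)) //.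
    apply: eq_sw => h' h3.
    rewrite (sw_qt (F := fun a b => S (S h3) * S b * a)) //.
    rewrite /u lin_tlift // lin_tlift //; apply: eq_sw => r1 r2.
    transitivity (\sw_(h1, h2 <- Delta h') (S (S h3) * (S r2 * (S h1 * h2) * r1))).
      by rewrite (sw_antipodel (fun z => S (S h3) * (S r2 * z * r1))) ?mulr1.
    by apply: eq_sw => a b; rewrite antipodeM !mulrA.
  rewrite /T.
  under eq_sw => h' h3 do rewrite sw_exch.
  rewrite sw_coassoc //.
  rewrite -[RHS](sw_counitr (hH := hH) (fun z => u * z)) //; apply: eq_sw => h1 w.
  rewrite sw_exch /u (lin_tlift (f := fun z => z * h1)) // lin_tlift //.
  apply: eq_sw => r1 r2.
  transitivity (\sw_(h2, h3 <- Delta w) (S (h2 * S h3) * (S r2 * r1 * h1))).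
    by apply: eq_sw => h2 h3; rewrite !antipodeM !mulrA.
  rewrite (sw_antipoder (fun z => S z * (S r2 * r1 * h1))) //.
  by rewrite antipode1 mul1r.
exists u, (\sw_(q1, q2 <- R) (q2 * S (S q1))); split=> //.
rewrite (lin_tlift (f := fun z => z * u)) //.
under eq_sw => q1 q2 do rewrite -mulrA uE /u mulrA
  (lin_tlift (f := fun z => q2 * z * q1)) //.
rewrite sw_exch.
transitivity (\sw_(r1, r2 <- R) \sw_(b, c <- Delta r2) (b * S c * r1)).
  rewrite (sw_qt_r (F := fun a b c => b * S c * a)) //; apply: eq_sw => r1 r2.
  by apply: eq_sw => q1 q2; rewrite !mulrA.
under eq_sw => r1 r2 do rewrite (sw_antipoder (fun z => z * r1)) // mul1r.
exact: R_counitr.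
Qed.

Lemma antipode_inj : injective S.
Proof.
have [u [v [vu uE]]] := antipode_sq_drinfeld.
apply: (can_inj (g := fun x => v * (S x * u))) => h.
by rewrite uE mulrA vu mul1r.
Qed.

Lemma antipode_bij : exists T : {linear H -> H}, cancel S T /\ cancel T S.
Proof.
pose s := linfun S : 'End(H).
have k0 : lker s == 0%VS.
  by apply/lker0P => x y; rewrite !lfunE => /antipode_inj.
exists (s^-1)%VF; split=> x.
  by have := lker0_lfunK k0 x; rewrite [s x]lfunE.
by have := lker0_lfunVK k0 x; rewrite [s _]lfunE.
Qed.

End Quasitriangular.

(** * The transmuted coproduct *)

Section Transmutation.
Variables (k : fieldType) (H : falgType k) (hH : hopf_algebra H) (R : tensor H H).
Hypothesis qt : quasi_triangular hH R.
Implicit Type X : vectType k.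
Local Notation Delta := (coprod hH).
Local Notation eps := (counit hH).
Local Notation S := (antipode hH).
Local Notation DeltaR := (coprodR hH R).
Local Notation ad := (ad hH).

Lemma sw_coprodR X (F : H -> H -> X) h : bilin F ->
  \sw_(x, y <- DeltaR h) F x y =
  \sw_(a, b <- Delta h) \sw_(r1, r2 <- R) F (a * S r2) (ad r1 b).
Proof.
move=> L; rewrite /coprodR sw_sw; apply: eq_sw => a b; rewrite sw_sw.
by apply: eq_sw => r1 r2; rewrite sw_tens.
Qed.

(** Both sides reduce to
    g_(1) h_(1) S(R^2 g_(3)) ⊗ (R^1 g_(2)).h_(2), which is M: the right-hand side
    after exchanging R with Delta(g), the left-hand side because the inner
    adjoint action reassembles from the middle legs of Delta(g). *)
Lemma sw_coprodR_ad X (F : H -> H -> X) g h : bilin F ->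
  \sw_(x, y <- DeltaR (ad g h)) F x y =
  \sw_(a, b <- Delta g) \sw_(x, y <- DeltaR h) F (ad a x) (ad b y).
Proof.
move=> L; pose M := \sw_(p, w <- Delta g) \sw_(h1, h2 <- Delta h)
  \sw_(r1, r2 <- R) \sw_(z, t <- Delta w)
    F (p * h1 * S (r2 * t)) (ad (r1 * z) h2).
transitivity M.
  rewrite sw_coprodR // /(ad g h).
  rewrite (lin_tlift (f := fun v => \sw_(a, b <- Delta v)
    \sw_(r1, r2 <- R) F (a * S r2) (ad r1 b))) //.
  under eq_sw => g1 g'.
    rewrite sw_coprodM // sw_coprodM //.
    under eq_sw => p q do under eq_sw => h1 h2 do rewrite sw_coprod_antipode //.
    over.
  rewrite sw_coassoc //; apply: eq_sw => p w.
  rewrite sw_exch; apply: eq_sw => h1 h2; rewrite -sw_coassoc //.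
  under eq_sw => z t do rewrite sw_exch.
  rewrite sw_exch; apply: eq_sw => r1 r2; apply: eq_sw => z t.
  rewrite adM /(ad z h2).
  rewrite (lin_tlift (f := fun y => F (p * h1 * S (r2 * t)) (ad r1 y))) //.
  by apply: eq_sw => q s; rewrite antipodeM !mulrA.
rewrite /M.
under [RHS]eq_sw => a b.
  rewrite sw_coprodR // {1}/ad.
  under eq_sw => h1 h2 do under eq_sw => r1 r2 do
    (rewrite -adM (lin_tlift (f := fun x => F x (ad (b * r1) h2))) //).
  under eq_sw => h1 h2 do rewrite sw_exch.
  rewrite sw_exch.
  over.
rewrite [RHS]sw_coassoc //; apply: eq_sw => p w.
rewrite [RHS]sw_exch; apply: eq_sw => h1 h2.
rewrite (sw_qt qt (F := fun x y => F (p * h1 * S y) (ad x h2))) // [RHS]sw_exch.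
by apply: eq_sw => r1 r2; apply: eq_sw => q b; rewrite antipodeM !mulrA.
Qed.

(** On the left, (id ⊗ Delta) R = R^13 R^12 expands Delta(S(R^2)); on the right,
    H-linearity of Delta_R and (Delta ⊗ id) R = R^13 R^23 expand Delta_R(R^1.h).
    The results agree up to the coassociativity of Delta. *)
Lemma sw_coprodR_coassoc X (F : H -> H -> H -> X) h : trilin F ->
  \sw_(x, y <- DeltaR h) \sw_(x1, x2 <- DeltaR x) F x1 x2 y =
  \sw_(x, y <- DeltaR h) \sw_(y1, y2 <- DeltaR y) F x y1 y2.
Proof.
move=> L; pose M a1 a2 b := \sw_(R1, R2 <- R) \sw_(Q1, Q2 <- R) \sw_(r1, r2 <- R)
  F (a1 * S (r2 * R2)) (ad r1 (a2 * S Q2)) (ad (R1 * Q1) b).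
transitivity (\sw_(a, b <- Delta h) \sw_(a1, a2 <- Delta a) M a1 a2 b).
  rewrite sw_coprodR //; apply: eq_sw => a b.
  under eq_sw => r1 r2 do rewrite sw_coprodR // sw_coprodM //.
  rewrite sw_exch; apply: eq_sw => a1 a2.
  under eq_sw => R1 R2 do rewrite sw_coprod_antipode //.
  rewrite (sw_qt_r qt (F := fun R1 m n => \sw_(r1, r2 <- R)
    F (a1 * S n * S r2) (ad r1 (a2 * S m)) (ad R1 b))) //.
  apply: eq_sw => R1 R2; apply: eq_sw => Q1 Q2; apply: eq_sw => r1 r2.
  by rewrite antipodeM mulrA.
rewrite /M sw_coassoc // [RHS]sw_coprodR //; apply: eq_sw => a b.
under [RHS]eq_sw => R1 R2 do rewrite sw_coprodR_ad //.
rewrite (sw_qt_l qt (F := fun m n R2 => \sw_(x, y <- DeltaR b)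
  F (a * S R2) (ad m x) (ad n y))) //.
under [RHS]eq_sw => r1 r2 do under eq_sw => R1 R2 do rewrite sw_coprodR //.
under [RHS]eq_sw => r1 r2 do rewrite sw_exch.
rewrite [RHS]sw_exch; apply: eq_sw => b1 b2.
rewrite [RHS]sw_exch; apply: eq_sw => R1 R2.
rewrite sw_exch; apply: eq_sw => r1 r2; apply: eq_sw => Q1 Q2.
by rewrite adM.
Qed.

Lemma sw_coprodR_counitl X (F : H -> X) h : islin F ->
  \sw_(x, y <- DeltaR h) (eps x *: F y) = F h.
Proof.
move=> L; rewrite sw_coprodR // -[RHS](sw_counitl (hH := hH) F) //.
apply: eq_sw => a b; rewrite -{2}[b](ad1 hH).
rewrite -(sw_R_counitr qt (F := fun z => F (ad z b))) //.
rewrite lin_tlift //; apply: eq_sw => r1 r2.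
by rewrite counitM counit_antipode scalerA.
Qed.

Lemma sw_coprodR_counitr X (F : H -> X) h : islin F ->
  \sw_(x, y <- DeltaR h) (eps y *: F x) = F h.
Proof.
move=> L; rewrite sw_coprodR // -[RHS](sw_counitr (hH := hH) F) //.
apply: eq_sw => a b; rewrite -{2}[a]mulr1 -(antipode1 hH).
rewrite -(sw_R_counitl qt (F := fun z => F (a * S z))) //.
rewrite lin_tlift //; apply: eq_sw => r1 r2.
by rewrite counit_ad scalerA mulrC.
Qed.

End Transmutation.

(** * The structure restricted to D *)

Section Subcoalgebra.
Variables (k : fieldType) (H : falgType k) (hH : hopf_algebra H) (R : tensor H H).
Hypothesis qt : quasi_triangular hH R.
Variable D : {vspace H}.
Hypothesis modD : module_subcoalgebra hH R D.
Implicit Type X : vectType k.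
Local Notation Delta := (coprod hH).
Local Notation eps := (counit hH).
Local Notation S := (antipode hH).
Local Notation DeltaR := (coprodR hH R).
Local Notation ad := (ad hH).
Local Notation adD := (adD hH).
Local Notation Dt := (subvs_of D).
Local Notation DeltaD := (sub_coprod DeltaR (D := D)).

(** The coproduct of D is defined through the projection of H onto D; because
    Delta_R(D) lies in D ⊗ D, no information is lost, and the identities proved on H
    transfer to D. *)
Lemma sw_vsval X (F : H -> H -> X) (d : Dt) : bilin F ->
  \sw_(a, b <- DeltaR (vsval d)) F a b = \sw_(a, b <- DeltaD d) F (vsval a) (vsval b).
Proof.
move=> L; have [t e] := modD.1 _ (subvsP d).
rewrite /sub_coprod e !sw_sw; apply: eq_sw => a b.
by rewrite !sw_tens // !vsvalK.
Qed.

Lemma vsval_adD h (d : Dt) : vsval (adD h d) = ad h (vsval d).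
Proof. by rewrite vsprojK //; apply: modD.2; apply: subvsP. Qed.

Lemma adD1 (d : Dt) : adD 1 d = d.
Proof. by apply: val_inj; rewrite [LHS]vsval_adD ad1. Qed.

Lemma adDM (g h : H) (d : Dt) : adD (g * h) d = adD g (adD h d).
Proof. by apply: val_inj; rewrite [LHS]vsval_adD adM -!vsval_adD. Qed.

Lemma sw_DeltaD_adD X (F : Dt -> Dt -> X) h (d : Dt) : bilin F ->
  \sw_(x, y <- DeltaD (adD h d)) F x y =
  \sw_(a, b <- Delta h) \sw_(x, y <- DeltaD d) F (adD a x) (adD b y).
Proof.
move=> L; pose G a b := F (vsproj D a) (vsproj D b).
have GE a b : F a b = G (vsval a) (vsval b) by rewrite /G !vsvalK.
under eq_sw => a b do rewrite GE.
rewrite -sw_vsval /G // vsval_adD sw_coprodR_ad //.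
by apply: eq_sw => a b; rewrite sw_vsval.
Qed.

Lemma sw_DeltaD_coassoc X (F : Dt -> Dt -> Dt -> X) (d : Dt) : trilin F ->
  \sw_(x, y <- DeltaD d) \sw_(x1, x2 <- DeltaD x) F x1 x2 y =
  \sw_(x, y <- DeltaD d) \sw_(y1, y2 <- DeltaD y) F x y1 y2.
Proof.
move=> L; pose G a b c := F (vsproj D a) (vsproj D b) (vsproj D c).
have GE a b c : F a b c = G (vsval a) (vsval b) (vsval c) by rewrite /G !vsvalK.
have LG : trilin G by rewrite /G.
under eq_sw => x y do (under eq_sw => a b do rewrite GE;
  rewrite -(sw_vsval (F := fun a b => G a b (vsval y))) //).
under [RHS]eq_sw => x y do (under eq_sw => a b do rewrite GE;
  rewrite -(sw_vsval (F := fun a b => G (vsval x) a b)) //).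
rewrite -(sw_vsval (F := fun x y => \sw_(a, b <- DeltaR x) G a b y)) //.
rewrite -(sw_vsval (F := fun x y => \sw_(a, b <- DeltaR y) G x a b)) //.
exact: sw_coprodR_coassoc.
Qed.

Lemma sw_DeltaD_counitl X (F : Dt -> X) (d : Dt) : islin F ->
  \sw_(x, y <- DeltaD d) (eps (vsval x) *: F y) = F d.
Proof.
move=> L; under eq_sw => a b do rewrite -[b in F b]vsvalK.
rewrite -(sw_vsval (F := fun a b => eps a *: F (vsproj D b))) //.
by rewrite (sw_coprodR_counitl qt (F := fun b => F (vsproj D b))) // vsvalK.
Qed.

Lemma sw_DeltaD_counitr X (F : Dt -> X) (d : Dt) : islin F ->
  \sw_(x, y <- DeltaD d) (eps (vsval y) *: F x) = F d.
Proof.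
move=> L; under eq_sw => a b do rewrite -[a in F a]vsvalK.
rewrite -(sw_vsval (F := fun a b => eps b *: F (vsproj D a))) //.
by rewrite (sw_coprodR_counitr qt (F := fun b => F (vsproj D b))) // vsvalK.
Qed.

End Subcoalgebra.

(** * Elements of V^* ⊗ W as linear maps *)

Section Ev.
Variables (k : fieldType) (V : vectType k).
Implicit Types W X Y : vectType k.

Definition of_map W (g : V -> W) : tensor (dual V) W :=
  \sum_i dual_vec i ⊗ g (vbasis {: V})`_i.

Lemma ev_tens W (f : dual V) (w : W) v : ev (f ⊗ w) v = f v *: w.
Proof. by rewrite /ev sw_tens. Qed.

Lemma ev_sw W X Y (F : X -> Y -> tensor (dual V) W) t v :
  ev (\sw_(a, b <- t) F a b) v = \sw_(a, b <- t) ev (F a b) v.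
Proof. by rewrite (lin_tlift (f := fun s => ev s v)). Qed.

Lemma ev_of_map W (g : V -> W) v : islin g -> ev (of_map g) v = g v.
Proof.
move=> L; rewrite (lin_sum (f := fun s => ev s v)) //.
rewrite [in RHS](coord_vbasis (memvf v)) lin_sum //; apply: eq_bigr => i _.
by rewrite ev_tens dual_vecE linZ.
Qed.

Lemma dual_vec_sum (f : dual V) :
  f = \sum_(i < \dim {: V}) f (vbasis {: V})`_i *: dual_vec i.
Proof.
apply/lfunP => v; rewrite (lin_sum (f := fun g : dual V => g v : k^o)) //.
rewrite [in LHS](coord_vbasis (memvf v)) linear_sum; apply: eq_bigr => i _.
by rewrite linearZ /= lfunE /= dual_vecE [RHS]mulrC.
Qed.

Lemma of_map_ev W (t : tensor (dual V) W) : of_map (ev t) = t.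
Proof.
have lin_of : islin (fun t : tensor (dual V) W => of_map (ev t)).
  move=> c x y; rewrite /of_map scaler_sumr -big_split; apply: eq_bigr => i _.
  exact: (_ : islin (fun x : tensor (dual V) W =>
    dual_vec i ⊗ ev x (vbasis {: V})`_i)).
rewrite [RHS]tens_span {1}[t]tens_span.
rewrite (lin_tlift (f := fun t : tensor (dual V) W => of_map (ev t))) //.
apply: eq_sw => f w.
rewrite [in RHS](dual_vec_sum f) (lin_sum (f := fun g => g ⊗ w)) //.
apply: eq_bigr => i _; rewrite ev_tens.
by rewrite (linZ (f := fun z => dual_vec i ⊗ z)) // (linZ (f := fun g => g ⊗ w)).
Qed.

Lemma ev_inj W (s t : tensor (dual V) W) : (forall v, ev s v = ev t v) -> s = t.
Proof.
move=> e; rewrite -(of_map_ev s) -(of_map_ev t).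
by apply: eq_bigr => i _; rewrite e.
Qed.

(** The form of dual_coactE for a coaction that is only known to be linear. *)
Lemma ev_dual_coact (C : vectType k) (rho : V -> tensor C V) (f : dual V) v :
  islin rho -> ev (dual_coact rho f) v = \sw_(c, w <- rho v) (f w *: c).
Proof.
move=> L; pose r : {linear V -> tensor C V} :=
  HB.pack rho (GRing.isSemilinear.Build k V (tensor C V) _ rho
    (GRing.semilinear_linear L)).
exact: (dual_coactE r).
Qed.

End Ev.

Section Bind.
Variables (k : fieldType) (H : falgType k) (V : vectType k).
Implicit Types (t : tensor H V) (phi psi : V -> tensor H V).

(** The Kleisli extension of phi for the monad H ⊗ - given by the algebra H; the
    product of N_D is Kleisli composition, see ev_N_mul. *)
Definition bind t phi : tensor H V :=
  \sw_(g, v <- t) \sw_(h, w <- phi v) ((g * h) ⊗ w).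

Lemma bind1l v phi : islin phi -> bind (1 ⊗ v) phi = phi v.
Proof.
move=> L; rewrite /bind sw_tens // [RHS]tens_span; apply: eq_sw => h w.
by rewrite mul1r.
Qed.

Lemma bind1r t : bind t (fun v => 1 ⊗ v) = t.
Proof.
by rewrite [RHS]tens_span; apply: eq_sw => h w; rewrite sw_tens // mulr1.
Qed.

Lemma bindA t phi psi : islin psi ->
  bind (bind t phi) psi = bind t (fun v => bind (phi v) psi).
Proof.
move=> L; rewrite /bind sw_sw; apply: eq_sw => g v; rewrite !sw_sw.
apply: eq_sw => h w; rewrite sw_tens // sw_sw; apply: eq_sw => a b.
by rewrite sw_tens // mulrA.
Qed.

End Bind.

(** * The isomorphism *)

Section Main.
Variables (k : fieldType) (H : falgType k) (hH : hopf_algebra H) (R : tensor H H).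
Hypothesis qt : quasi_triangular hH R.
Variable D : {vspace H}.
Hypothesis modD : module_subcoalgebra hH R D.
Implicit Type X : vectType k.
Local Notation Delta := (coprod hH).
Local Notation eps := (counit hH).
Local Notation S := (antipode hH).
Local Notation ad := (ad hH).
Local Notation adD := (adD hH).
Local Notation Dt := (subvs_of D).
Local Notation DeltaD := (sub_coprod (coprodR hH R) (D := D)).
Local Notation Dual := (dual Dt).
Local Notation HD := (tensor H Dt).
Local Notation coact := (coactHD hH R (D := D)).

(** The cotensor condition says that ev x is colinear. *)
Lemma mem_N (x : tensor Dual HD) : x \in N_space hH R D <->
  forall d, coact (ev x d) = \sw_(a, b <- DeltaD d) (vsval a ⊗ ev x b).
Proof.
have evl d : ev (\sw_(m, n <- x) (m ⊗ coact n)) d = coact (ev x d).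
  rewrite ev_sw /(ev x d) lin_tlift //; apply: eq_sw => m n.
  by rewrite ev_tens linZ.
have evr d : ev (\sw_(m, n <- x) \sw_(m0, c <- dual_coact (coactD hH R (D := D)) m)
    (m0 ⊗ (c ⊗ n))) d = \sw_(a, b <- DeltaD d) (vsval a ⊗ ev x b).
  rewrite ev_sw; under [RHS]eq_sw => a b do
    rewrite /ev (lin_tlift (f := fun z => vsval a ⊗ z)) //.
  rewrite [RHS]sw_exch; apply: eq_sw => m n; rewrite ev_sw.
  transitivity (ev (dual_coact (coactD hH R (D := D)) m) d ⊗ n).
    rewrite /ev (lin_tlift (f := fun z => z ⊗ n)) //; apply: eq_sw => m0 c.
    by rewrite sw_tens // (linZ (f := fun z => z ⊗ n)).
  rewrite ev_dual_coact; last by rewrite /coactD.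
  rewrite /coactD sw_sw (lin_tlift (f := fun z => z ⊗ n)) //.
  apply: eq_sw => a b; rewrite sw_tens //.
  by rewrite (linZ (f := fun z => z ⊗ n)) // (linZ (f := fun z => vsval a ⊗ z)).
split=> [/mem_cotensor e d|e]; first by rewrite -evl -evr e.
by apply/mem_cotensor/ev_inj => d; rewrite evl evr e.
Qed.

Lemma ev_N_mul (x y : tensor Dual HD) d :
  ev (N_mul x y) d = bind (ev y d) (ev x).
Proof.
have bindE gv : bind gv (ev x) = \sw_(w', hw <- x) \sw_(h, w <- hw)
    \sw_(g, v <- gv) ((g * h) ⊗ ((w' : Dual) v *: w)).
  rewrite /bind; under eq_sw => g v do rewrite /ev sw_sw.
  rewrite sw_exch; apply: eq_sw => w' hw; rewrite [RHS]sw_exch.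
  apply: eq_sw => g v; rewrite (linZ (f := tlift _)) // lin_tlift //.
  apply: eq_sw => h w.
  by rewrite (linZ (f := fun z => (g * h) ⊗ z)).
transitivity (\sw_(v', gv <- y) (((v' : Dual) d : k) *: bind gv (ev x))); last first.
  by rewrite /(ev y d) /bind sw_sw; apply: eq_sw => f w; rewrite linearZ.
rewrite /N_mul ev_sw.
under [RHS]eq_sw => v' gv do
  rewrite bindE (lin_tlift (f := *:%R ((v' : Dual) d : k))) //.
rewrite [RHS]sw_exch; apply: eq_sw => w' hw; rewrite ev_sw.
under [RHS]eq_sw => v' gv do rewrite (lin_tlift (f := *:%R ((v' : Dual) d : k))) //.
rewrite [RHS]sw_exch; apply: eq_sw => h w; rewrite ev_sw.
apply: eq_sw => v' gv; rewrite ev_sw lin_tlift //; apply: eq_sw => g v.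
by rewrite ev_tens.
Qed.

Lemma ev_N_one d : ev (@N_one k H D) d = 1 ⊗ d.
Proof. by rewrite (ev_of_map (g := fun d : Dt => (1 : H) ⊗ d)). Qed.

(** The map f ∘ beta(h), with beta(h) d = S^2(h_(2)) ⊗ S(h_(1)).d. *)
Definition smash_map (f : Dual) (h : H) (d : Dt) : Vector.sort HD :=
  \sw_(p, q <- Delta h) \sw_(a, b <- DeltaD (adD (S p) d))
    ((f b : k) *: (S (S q) ⊗ a)).

Definition smash_to_N (x : tensor Dual H) : tensor Dual HD :=
  of_map (fun d => \sw_(f, h <- x) smash_map f h d).

Lemma ev_smash_to_N x d : ev (smash_to_N x) d = \sw_(f, h <- x) smash_map f h d.
Proof. by rewrite ev_of_map //; rewrite /smash_map. Qed.

(** With e = S(h'_(1)).d, the left-hand side ends in f'(h_(1) S(h_(2)).e^(2)): the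
    H-linearity of Delta_R splits S(h_(2)).e, the leg that meets f' cancels against
    the h_(1) of the smash product, and what is left is the composition. *)
Lemma smash_map_mul f h f' h' d :
  \sw_(h1, k <- Delta h) smash_map (convR hH R f (dual_act hH f' h1)) (h' * k) d =
  bind (smash_map f' h' d) (smash_map f h).
Proof.
pose G e q' := \sw_(x, y <- DeltaD e) \sw_(p, q <- Delta h)
  \sw_(a, b <- DeltaD (adD (S p) x))
    ((f b : k) *: ((f' y : k) *: ((S (S q') * S (S q)) ⊗ a))).
transitivity (\sw_(p', q' <- Delta h') G (adD (S p') d) q').
  rewrite /smash_map; under eq_sw => h1 w do rewrite sw_coprodM //.
  rewrite sw_exch; apply: eq_sw => p' q'; rewrite /G.
  under eq_sw => h1 w do under eq_sw => p q do rewrite !antipodeM (adDM modD).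
  move: (adD (S p') d) => e.
  (* In K c v, the element c is what acts on the argument of f'; it starts as
     h_(1) S(h_(2)) and collapses to 1. *)
  pose T q a := (S (S q') * S (S q)) ⊗ a : tensor H Dt.
  pose K c v := \sw_(p, q <- Delta v) \sw_(x, y <- DeltaD e)
    \sw_(a, b <- DeltaD (adD (S p) x)) ((f b : k) *: ((f' (adD c y) : k) *: T q a)).
  transitivity (K 1 h); last first.
    rewrite /K sw_exch; apply: eq_sw => x y; apply: eq_sw => p q.
    by rewrite (adD1 modD).
  transitivity (\sw_(h1, w <- Delta h) \sw_(p1, z <- Delta w)
    K (h1 * S p1) z); last first.
    rewrite -sw_coassoc; last by rewrite /K /T.
    rewrite -(sw_counitl (hH := hH) (fun v => K 1 v)); last by rewrite /K /T.
    apply: eq_sw => z w.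
    by rewrite (sw_antipoder (fun c => K c w)) // /K /T.
  apply: eq_sw => h1 w; rewrite /K -sw_coassoc; last by rewrite /T.
  apply: eq_sw => p q.
  transitivity (\sw_(a, b <- DeltaD (adD (S p) e)) \sw_(b1, b2 <- DeltaD b)
      ((f b1 : k) *: ((f' (adD h1 b2) : k) *: T q a))).
    apply: eq_sw => a b; rewrite convRE (lin_tlift (f := fun c : k^o => c *: T q a)) //.
    by apply: eq_sw => b1 b2; rewrite dual_actE scalerA.
  rewrite -(sw_DeltaD_coassoc qt modD (F := fun a b c =>
    (f b : k) *: ((f' (adD h1 c) : k) *: T q a))); last by rewrite /T.
  rewrite (sw_DeltaD_adD qt modD); last by rewrite /T.
  rewrite sw_coprod_antipode; last by rewrite /T.
  apply: eq_sw => p1 p2; apply: eq_sw => x y; apply: eq_sw => a b.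
  by rewrite (adDM modD).
rewrite /bind sw_sw; apply: eq_sw => p' q'.
rewrite sw_sw /G; apply: eq_sw => x y.
rewrite linearZ /= sw_tens; last by rewrite /smash_map.
rewrite /smash_map sw_sw (lin_tlift (f := *:%R (f' y : k))) //; apply: eq_sw => p q.
rewrite (lin_tlift (f := *:%R (f' y : k))) // [RHS]sw_sw; apply: eq_sw => a b.
by rewrite [RHS](linZ (f := tlift _)) // sw_tens.
Qed.

Lemma smash_to_N1 : smash_to_N (smash_one hH D) = @N_one k H D.
Proof.
apply: ev_inj => d; rewrite ev_smash_to_N ev_N_one /smash_one.
rewrite sw_tens; last by rewrite /smash_map.
rewrite /smash_map sw_coprod1 // !antipode1 (adD1 modD).
under eq_sw => a b do rewrite epsDE.
by rewrite (sw_DeltaD_counitr qt modD (F := fun a => 1 ⊗ a)).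
Qed.

(** The coaction produces S^2(h_(3)) S(h_(2)).d^(1), where S^2(h_(3)) comes from the
    H-component and S(h_(2)) from the H-linearity of Delta_R; this is
    S(h_(2) S(h_(3))).d^(1), which the antipode axiom reduces to d^(1). *)
Lemma smash_map_comodule_map f h d :
  coact (smash_map f h d) = \sw_(x, y <- DeltaD d) (vsval x ⊗ smash_map f h y).
Proof.
rewrite /smash_map lin_tlift //.
transitivity (\sw_(p, q <- Delta h) \sw_(p1, p2 <- Delta p) \sw_(q1, q2 <- Delta q)
  \sw_(x, y <- DeltaD d) \sw_(a, b <- DeltaD (adD (S p1) y))
    ((f b : k) *: (ad (S (p2 * S q1)) (vsval x) ⊗ (S (S q2) ⊗ a)))).
  apply: eq_sw => p q; rewrite lin_tlift //.
  transitivity (\sw_(x, y <- DeltaD (adD (S p) d)) \sw_(a, b <- DeltaD y)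
    \sw_(q1, q2 <- Delta q)
      ((f b : k) *: (ad (S (S q1)) (vsval x) ⊗ (S (S q2) ⊗ a)))).
    rewrite -(sw_DeltaD_coassoc qt modD (F := fun x a b =>
      \sw_(q1, q2 <- Delta q)
      ((f b : k) *: (ad (S (S q1)) (vsval x) ⊗ (S (S q2) ⊗ a))))) //.
    apply: eq_sw => a b; rewrite linZ // /coactHD sw_tens // sw_antipode_sq //.
    rewrite lin_tlift // [RHS]sw_exch; apply: eq_sw => q1 q2.
    by rewrite lin_tlift.
  rewrite (sw_DeltaD_adD qt modD) // sw_coprod_antipode //; apply: eq_sw => p1 p2.
  under eq_sw => x y do rewrite sw_exch.
  rewrite sw_exch; apply: eq_sw => q1 q2; apply: eq_sw => x y; apply: eq_sw => a b.
  by rewrite (vsval_adD modD) -adM antipodeM.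
rewrite sw_coassoc //.
under [RHS]eq_sw => x y do rewrite (lin_tlift (f := fun t => vsval x ⊗ t)) //.
rewrite [RHS]sw_exch; apply: eq_sw => p1 w; rewrite -sw_coassoc //.
under [RHS]eq_sw => x y do rewrite (lin_tlift (f := fun t => vsval x ⊗ t)) //.
pose G c v := \sw_(x, y <- DeltaD d) \sw_(a, b <- DeltaD (adD (S p1) y))
  ((f b : k) *: (ad (S c) (vsval x) ⊗ (S (S v) ⊗ a))).
transitivity (G 1 w).
  rewrite -(sw_counitl (hH := hH) (fun v => G 1 v)); last by rewrite /G.
  apply: eq_sw => z q2; rewrite -(sw_antipoder (fun c => G c q2)) //.
  by rewrite /G.
apply: eq_sw => x y; apply: eq_sw => a b.
by rewrite antipode1 ad1 (linZ (f := fun t => vsval x ⊗ t)).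
Qed.

Lemma smash_to_N_in x : smash_to_N x \in N_space hH R D.
Proof.
apply/mem_N => d; rewrite ev_smash_to_N lin_tlift //.
under [RHS]eq_sw => a b do
  rewrite ev_smash_to_N (lin_tlift (f := fun t => vsval a ⊗ t)) //.
rewrite [RHS]sw_exch; apply: eq_sw => f h.
exact: smash_map_comodule_map.
Qed.

Lemma smash_map_lin d : bilin (fun f h => smash_map f h d).
Proof. by rewrite /smash_map. Qed.

Lemma smash_to_NM x y :
  smash_to_N (smash_mul hH R x y) = N_mul (smash_to_N x) (smash_to_N y).
Proof.
apply: ev_inj => d; have Lth := smash_map_lin d.
rewrite ev_N_mul !ev_smash_to_N /smash_mul [LHS]sw_sw.
under eq_sw => f h.
  rewrite sw_sw; under eq_sw => f' h' do
    (rewrite sw_sw; under eq_sw => h1 h2 do rewrite sw_tens //; rewrite smash_map_mul).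
  over.
rewrite /bind [RHS]sw_sw sw_exch; apply: eq_sw => f' h'.
rewrite [RHS](_ : _ = \sw_(g, v <- smash_map f' h' d) \sw_(f, h <- x)
  \sw_(a, w <- smash_map f h v) ((g * a) ⊗ w)).
  by rewrite [RHS]sw_exch.
by apply: eq_sw => g v; rewrite ev_smash_to_N sw_sw.
Qed.

Lemma dual_actM (f : Dual) (g h : H) :
  dual_act hH (dual_act hH f g) h = dual_act hH f (g * h).
Proof. by apply/lfunP => d; rewrite !dual_actE (adDM modD). Qed.

Lemma dual_act1 (f : Dual) : dual_act hH f 1 = f.
Proof. by apply/lfunP => d; rewrite dual_actE (adD1 modD). Qed.

(** In terms of maps, phi |-> (id ⊗ eps) phi, from Hom(D, H ⊗ D) to Hom(D, H). *)
Definition counit_part (x : tensor Dual HD) : tensor Dual H :=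
  \sw_(f, t <- x) (f ⊗ \sw_(h, v <- t) (eps (vsval v) *: h)).

Lemma ev_counit_part x d :
  ev (counit_part x) d = \sw_(h, v <- ev x d) (eps (vsval v) *: h).
Proof.
rewrite /counit_part ev_sw [in RHS]/ev sw_sw; apply: eq_sw => f t.
by rewrite ev_tens [RHS](linZ (f := tlift _)).
Qed.

Lemma counit_part_smash x : counit_part (smash_to_N x) =
  \sw_(f, h <- x) \sw_(p, q <- Delta h) (dual_act hH f (S p) ⊗ S (S q)).
Proof.
apply: ev_inj => d; rewrite ev_counit_part ev_smash_to_N sw_sw ev_sw.
apply: eq_sw => f h; rewrite ev_sw /smash_map sw_sw; apply: eq_sw => p q.
rewrite ev_tens dual_actE [LHS]sw_sw.
rewrite -(sw_DeltaD_counitl qt modD (F := fun b => (f b : k) *: S (S q))) //.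
apply: eq_sw => a b; rewrite [LHS](linZ (f := tlift _)) // sw_tens //.
by rewrite !scalerA mulrC.
Qed.

(** By counit_part_smash the map is f ⊗ h |-> (f ◁ S(h_(1))) ⊗ S^2(h_(2)). With T
    the inverse of S, a left inverse is g ⊗ h |-> (g ◁ a_(1)) ⊗ a_(2) for
    a = T(T h). *)
Lemma counit_part_smash_inj : injective (fun x => counit_part (smash_to_N x)).
Proof.
have [T [ST _]] := antipode_bij qt.
pose A (y : tensor Dual H) : tensor Dual H :=
  \sw_(f, h <- y) \sw_(a, b <- Delta (T (T h))) (dual_act hH f a ⊗ b).
apply: (can_inj (g := A)) => x; rewrite counit_part_smash /A sw_sw [RHS]tens_span.
apply: eq_sw => f h; rewrite sw_sw -[in RHS](dual_act1 f).
rewrite -(sw_counitl (hH := hH) (fun v => dual_act hH f 1 ⊗ v)) //.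
transitivity (\sw_(p, q <- Delta h) \sw_(a, b <- Delta q)
  (dual_act hH f (S p * a) ⊗ b)).
  apply: eq_sw => p q; rewrite sw_tens // !ST; apply: eq_sw => a b.
  by rewrite dual_actM.
rewrite -sw_coassoc //; apply: eq_sw => z b.
by rewrite (sw_antipodel (fun c => dual_act hH f c ⊗ b)).
Qed.

(** The identity S^-1(h_(2)) h_(1) = eps(h) 1 recovers h ⊗ d from its coaction (B
    below is the retraction). On a colinear map this gives
    phi(d) = q_(2) ⊗ S^-1(q_(1)).d^(1) with q = (id ⊗ eps) phi(d^(2)). *)
Lemma counit_part_inj : {in N_space hH R D &, injective counit_part}.
Proof.
have [T [ST TS]] := antipode_bij qt.
have T_antiM a b : T (a * b) = T b * T a.
  by apply: (can_inj ST); rewrite antipodeM !TS.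
have sw_T X (F : H -> X) h : islin F ->
    \sw_(a, b <- Delta h) F (T b * a) = eps h *: F 1.
  move=> L; rewrite -[1 in RHS]ST antipode1 -(sw_antipodel (fun z => F (T z))) //.
  by apply: eq_sw => a b; rewrite T_antiM ST.
pose B (s : tensor H HD) : Vector.sort HD := \sw_(c, t <- s) \sw_(h, w <- t)
  (eps (vsval w) *: \sw_(a, b <- Delta h) (b ⊗ vsproj D (ad (T a) c))).
have B_coact t : B (coact t) = t.
  rewrite /B sw_sw [RHS]tens_span; apply: eq_sw => h d.
  transitivity (\sw_(h1, h2 <- Delta h) \sw_(a, b <- Delta h2)
      (b ⊗ vsproj D (ad (T a * h1) (vsval d)))).
    rewrite sw_sw; apply: eq_sw => h1 h2.
    rewrite -(sw_DeltaD_counitr qt modD (F := fun d => \sw_(a, b <- Delta h2)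
      (b ⊗ vsproj D (ad (T a * h1) (vsval d))))) // [LHS]sw_sw.
    apply: eq_sw => d1 d2; rewrite !sw_tens //.
    by congr (_ *: _); apply: eq_sw => a b; rewrite adM.
  rewrite -sw_coassoc // -(sw_counitl (hH := hH) (fun b => b ⊗ d)) //.
  apply: eq_sw => z b.
  rewrite (sw_T _ (fun c => b ⊗ vsproj D (ad c (vsval d)))) //.
  by rewrite ad1 vsvalK.
have evE x d : x \in N_space hH R D -> ev x d = \sw_(a, b <- DeltaD d)
    \sw_(p, q <- Delta (ev (counit_part x) b)) (q ⊗ adD (T p) a).
  move=> /mem_N /(_ d) e; rewrite -[LHS]B_coact e /B [LHS]sw_sw.
  apply: eq_sw => a b; rewrite sw_tens // ev_counit_part.
  pose G v := \sw_(p, q <- Delta v) (q ⊗ adD (T p) a).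
  have LG : islin G by rewrite /G.
  rewrite -/(G _) [RHS](lin_tlift (f := G)) //.
  by apply: eq_sw => h w; rewrite [RHS]linZ.
move=> x y Nx Ny e; apply: ev_inj => d.
by rewrite !evE // e.
Qed.

Lemma smash_to_N_lin : islin smash_to_N.
Proof.
move=> c x y; apply: ev_inj => d.
by rewrite (_ : islin (fun t => ev t d)) // !ev_smash_to_N linearP.
Qed.

Lemma counit_part_lin : islin counit_part. Proof. by rewrite /counit_part. Qed.

Lemma smash_to_N_inj : injective smash_to_N.
Proof. by move=> x y e; apply: counit_part_smash_inj; rewrite /= e. Qed.

Lemma smash_to_N_onto x : x \in N_space hH R D -> exists y, smash_to_N y = x.
Proof.
move=> Nx; have L : islin (fun y => counit_part (smash_to_N y)).
  by apply: lin_comp; [exact: counit_part_lin | exact: smash_to_N_lin].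
have [y e] := lin_inj_surj L counit_part_smash_inj (counit_part x).
by exists y; apply: counit_part_inj => //; exact: smash_to_N_in.
Qed.

Lemma N_algebra : algebra_axioms (N_space hH R D) (@N_mul k H D) (@N_one k H D).
Proof.
split.
- by rewrite -smash_to_N1 smash_to_N_in.
- move=> x y /smash_to_N_onto[a <-] /smash_to_N_onto[b <-].
  by rewrite -smash_to_NM smash_to_N_in.
- by move=> c x y z _ _ _; rewrite /N_mul linearP.
- move=> c z x y _ _ _; apply: ev_inj => d.
  by rewrite (_ : islin (fun t => ev t d)) // !ev_N_mul /bind
    (_ : islin (fun t => ev t d)) // linearP.
- move=> x y z _ _ _; apply: ev_inj => d.
  rewrite !ev_N_mul bindA //; apply: eq_sw => g v.
  by rewrite ev_N_mul.
- move=> x _; apply: ev_inj => d; rewrite ev_N_mul.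
  rewrite -[RHS]bind1r; apply: eq_sw => g v.
  by rewrite ev_N_one.
- by move=> x _; apply: ev_inj => d; rewrite ev_N_mul ev_N_one bind1l.
Qed.

(** Each axiom is checked after the injective map smash_to_N, where it becomes the
    same axiom of N_D. *)
Lemma smash_algebra :
  algebra_axioms {: tensor Dual H}%VS (@smash_mul k H hH R D) (smash_one hH D).
Proof.
have [_ _ Dl Dr A l1 r1] := N_algebra; have in_N := smash_to_N_in.
split; try by move=> *; exact: memvf.
- move=> c x y z _ _ _; apply: smash_to_N_inj.
  by rewrite smash_to_N_lin !smash_to_NM smash_to_N_lin Dl ?in_N.
- move=> c z x y _ _ _; apply: smash_to_N_inj.
  by rewrite smash_to_N_lin !smash_to_NM smash_to_N_lin Dr ?in_N.
- by move=> x y z _ _ _; apply: smash_to_N_inj; rewrite !smash_to_NM A ?in_N.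
- by move=> x _; apply: smash_to_N_inj; rewrite smash_to_NM smash_to_N1 l1 ?in_N.
- by move=> x _; apply: smash_to_N_inj; rewrite smash_to_NM smash_to_N1 r1 ?in_N.
Qed.

Lemma N_isomorphic_smash : algebra_isomorphic
    (N_space hH R D) (@N_mul k H D) (@N_one k H D)
    {: tensor Dual H}%VS (@smash_mul k H hH R D) (smash_one hH D).
Proof.
split; [exact: N_algebra | exact: smash_algebra |].
have [F FE] := lin_hom smash_to_N_lin.
have F0 : lker F == 0%VS.
  by apply/lker0P => x y; rewrite !FE; exact: smash_to_N_inj.
have FK x : (F^-1)%VF (smash_to_N x) = x by rewrite -FE lker0_lfunK.
exists (F^-1)%VF; split.
- apply/eqP; rewrite -subv0; apply/subvP => x.
  rewrite memv_cap memv_ker => /andP[/smash_to_N_onto[a <-]].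
  by rewrite FK => /eqP->; rewrite -FE linear0 mem0v.
- apply/eqP; rewrite eqEsubv subvf; apply/subvP => x _.
  by rewrite -[x]FK memv_img // smash_to_N_in.
- move=> x y /smash_to_N_onto[a <-] /smash_to_N_onto[b <-].
  by rewrite -smash_to_NM !FK.
- by rewrite -smash_to_N1 FK.
Qed.

End Main.

Theorem proposition2p5 (k : fieldType) (H : falgType k) (hH : hopf_algebra H)
    (R : tensor H H) (D : {vspace H}) :
  [pchar k] =i pred0 ->
  semisimple H ->
  quasi_triangular hH R ->
  module_subcoalgebra hH R D ->
  algebra_isomorphic
    (N_space hH R D) (@N_mul k H D) (@N_one k H D)
    {: tensor (dual (subvs_of D)) H}%VS (@smash_mul k H hH R D) (smash_one hH D).
Proof. by move=> _ _ qt modD; apply: N_isomorphic_smash. Qed.
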